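(* Let $E$ be a topological vector space over an ultrametric field $(\mathbb{K},|\cdot|)$, let $\mathbb{O}:=\{x\in\mathbb{K}: |x|\leq 1\}$, let $\rho\in\mathbb{K}^\times$ with $|\rho|<1$, and let $(\gamma_n)_{n\in\mathbb{N}}$ be a sequence of smooth maps $\gamma_n\in BC^\infty(\rho^n\mathbb{O},E)$ which become small sufficiently fast in the sense that, for each gauge $q$ on $E$, there exists a calibration $(q_n)_{n\in\mathbb{N}_0}$ on $E$ extending $q$ (i.e. $q_0=q$) such that $$(\forall a>0)\,(\forall k,m\in\mathbb{N}_0)\quad \lim_{n\to\infty} a^n\,\|\gamma_n^{<k>}\|_{q_{n+m},\infty}=0 .$$ Then there exists a smooth map $\gamma\in BC^\infty(\mathbb{K},E)$ whose image satisfies $\operatorname{im}(\gamma)\subseteq\{0\}\cup\bigcup_{n\in\mathbb{N}}\operatorname{im}(\gamma_n)$, such that $$\gamma(\rho^{n-1}+t)=\gamma_n(t)\quad\text{for all } n\in\mathbb{N}\text{ and } t\in\rho^n\mathbb{O}.$$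
   Context: Conventions: $\mathbb{N}=\{1,2,\ldots\}$, $\mathbb{N}_0=\mathbb{N}\cup\{0\}$. A valued field is a field $\mathbb{K}$ with an absolute value $|\cdot|:\mathbb{K}\to[0,\infty[$ defining a non-discrete topology. An ultrametric field is a valued field with $|x+y|\leq\max\{|x|,|y|\}$ for all $x,y$. All topological vector spaces are assumed Hausdorff (no local convexity or completeness is assumed). $C^k$-maps: Let $U\subseteq\mathbb{K}$ be a non-empty subset without isolated points and $\gamma:U\to E$ a map to a topological $\mathbb{K}$-vector space. $\gamma$ is $C^0$ if it is continuous; then $\gamma^{<0>}:=\gamma$. Recursively, for $k\geq 1$, $\gamma$ is $C^k$ if it is $C^{k-1}$ and there is a (necessarily unique) continuous map $\gamma^{<k>}:U^{k+1}\to E$ such that $$\gamma^{<k>}(x_0,\ldots,x_k)=\frac{\gamma^{<k-1>}(x_k,x_1,\ldots,x_{k-1})-\gamma^{<k-1>}(x_0,x_1,\ldots,x_{k-1})}{x_k-x_0}$$ for all $(x_0,\ldots,x_k)\in U^{k+1}$ with $x_0\neq x_k$. $\gamma$ is $C^\infty$ (smooth) if it is $C^k$ for all $k\in\mathbb{N}_0$. A subset $A\subseteq E$ is bounded if for each $0$-neighbourhood $W\subseteq E$ there is a $0$-neighbourhood $V\subseteq\mathbb{K}$ with $VA\subseteq W$. $BC^\infty(U,E)$ is the space of all $C^\infty$-maps $\gamma:U\to E$ such that $\gamma^{<j>}$ has bounded image for each $j\in\mathbb{N}_0$. A gauge on $E$ is a map $q:E\to[0,\infty[$ (also written $\|\cdot\|_q$)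 such that $q(tx)=|t|q(x)$ for all $t\in\mathbb{K}$, $x\in E$, and $q^{-1}([0,r[)$ is a $0$-neighbourhood in $E$ for each $r>0$. A calibration on $E$ is a sequence $(q_n)_{n\in\mathbb{N}_0}$ of gauges on $E$ such that $q_n(x+y)\leq q_{n+1}(x)+q_{n+1}(y)$ for all $n\in\mathbb{N}_0$ and $x,y\in E$. For a gauge $q$ on $E$ and a $C^k$-map $\gamma:U\to E$, $\|\gamma^{<k>}\|_{q,\infty}:=\sup\{q(\gamma^{<k>}(x)): x\in U^{k+1}\}$. *)

(* Defs.v *)
From HB Require Import structures.
From mathcomp Require Import all_boot all_order all_algebra.
From mathcomp Require Import all_classical all_reals.
From mathcomp Require Import ereal topology pseudometric_normed_Zmodule.

Set Implicit Arguments.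
Unset Strict Implicit.
Unset Printing Implicit Defensive.

Import Order.TTheory GRing.Theory Num.Theory.
Import numFieldTopology.Exports.

Local Open Scope classical_set_scope.
Local Open Scope ring_scope.

(** A field with an absolute value inducing a non-discrete topology. *)
HB.mixin Record Field_Topological_isValued (R : realType) K
    & GRing.Field K & Topological K := {
  absv : K -> R ;
  absv_ge0 : forall x, 0 <= absv x ;
  absv_eq0 : forall x, absv x = 0 <-> x = 0 ;
  absvM : forall x y, absv (x * y) = absv x * absv y ;
  absvD : forall x y, absv (x + y) <= absv x + absv y ;
  nbhs_absv : forall (x : K) (A : set K), nbhs x A <->
    exists2 e : R, 0 < e & [set y | absv (x - y) < e] `<=` A ;
  absv_nondiscrete : ~ (forall A : set K, open A)
}.

#[short(type="valuedFieldType")]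
HB.structure Definition ValuedField (R : realType) :=
  {K of GRing.Field K & Topological K & Field_Topological_isValued R K}.

Definition ultrametric (R : realType) (K : valuedFieldType R) :=
  forall x y : K, absv (x + y) <= Num.max (absv x) (absv y).

(** [topologicalLmodType] requires an ordered scalar field, hence this counterpart
    over a valued field. It does not include the Hausdorff property. The file
    [tvs] must not be loaded here: its [NbhsLmodule] would be a superclass, whose
    scalars HB cannot unify with a valued field. *)
HB.mixin Record Topological_Lmodule_isValuedTvs (R : realType)
    (K : valuedFieldType R) E & Topological E & GRing.Lmodule K E := {
  vadd_continuous : continuous (fun z : E * E => z.1 + z.2) ;
  vscale_continuous : continuous (fun z : K * E => z.1 *: z.2)
}.

#[short(type="valuedTvsType")]
HB.structure Definition ValuedTvs (R : realType) (K : valuedFieldType R) :=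
  {E of Topological E & GRing.Lmodule K E
      & Topological_Lmodule_isValuedTvs R K E}.

(** The power [U^n], as a set of row vectors. *)
Definition rpow {R : realType} {K : valuedFieldType R} (U : set K) n
  : set 'rV[K]_n := [set x | forall i, U (x 0 i)].
Arguments rpow {R K} U n _.

Section Definitions.
Context {R : realType} {K : valuedFieldType R} {E : valuedTvsType K}.
Implicit Types (U : set K) (gamma : K -> E) (q : E -> R).

(** [(x_0, ..., x_{k+1})] is mapped to [(x_0, x_1, ..., x_k)], respectively to
    [(x_{k+1}, x_1, ..., x_k)]. *)
Definition row_init k (x : 'rV[K]_k.+2) : 'rV[K]_k.+1 :=
  \row_i x 0 (widen_ord (leqnSn k.+1) i).

Definition row_swap k (x : 'rV[K]_k.+2) : 'rV[K]_k.+1 :=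
  \row_i (if i == ord0 then x 0 ord_max else row_init x 0 i).

(** [f] is a continuous map on [U^(k+2)] extending the difference quotients
    of [g], a function on [U^(k+1)]; values off these sets are irrelevant. *)
Definition is_dquot U k (g : 'rV[K]_k.+1 -> E) (f : 'rV[K]_k.+2 -> E) :=
  {within rpow U k.+2, continuous f} /\
  forall x, rpow U k.+2 x -> x 0 ord0 != x 0 ord_max ->
    f x = (x 0 ord_max - x 0 ord0)^-1 *: (g (row_swap x) - g (row_init x)).

(** The map [gamma^<k>], only meaningful on [U^(k+1)] and if [gamma] is [C^k] on
    [U]; it is then unique there, provided that [E] is Hausdorff and [U] has no
    isolated points. *)
Fixpoint ddiff U gamma k : 'rV[K]_k.+1 -> E :=
  match k with
  | 0 => fun x => gamma (x 0 0)
  | k'.+1 => xget (fun=> 0) [set f | is_dquot U (@ddiff U gamma k') f]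
  end.
Arguments ddiff U gamma k _ : clear implicits.

Fixpoint Ck U k gamma : Prop :=
  match k with
  | 0 => {within U, continuous gamma}
  | k'.+1 => Ck U k' gamma /\ exists f, is_dquot U (ddiff U gamma k') f
  end.

Definition smooth U gamma := forall k, Ck U k gamma.

Definition tvs_bounded (A : set E) :=
  forall W : set E, nbhs 0 W ->
    exists2 V : set K, nbhs 0 V & forall t x, V t -> A x -> W (t *: x).

Definition BCoo U gamma :=
  smooth U gamma /\
  forall j, tvs_bounded (ddiff U gamma j @` rpow U j.+1).

Definition gauge q :=
  [/\ forall x, 0 <= q x,
      forall (t : K) x, q (t *: x) = absv t * q x &
      forall r, 0 < r -> nbhs 0 [set x | q x < r]].

Definition calibration (Q : nat -> E -> R) :=
  (forall n, gauge (Q n)) /\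
  forall n x y, Q n (x + y) <= Q n.+1 x + Q n.+1 y.

Definition ddiff_norm q U gamma k : \bar R :=
  ereal_sup [set (q (ddiff U gamma k x))%:E | x in rpow U k.+1].

End Definitions.
Arguments ddiff {R K E} U gamma k _.

Definition unit_ball {R : realType} (K : valuedFieldType R) : set K :=
  [set x | absv x <= 1].
Arguments unit_ball {R} K _.

Definition scaled_ball {R : realType} {K : valuedFieldType R} (rho : K) n
  : set K := [set rho ^+ n * x | x in unit_ball K].

(* Main.v *)
Require Import Defs.
From mathcomp Require Import all_boot all_order all_algebra.
From mathcomp Require Import all_classical all_reals.
From mathcomp Require Import ereal topology pseudometric_normed_Zmodule.
From mathcomp Require Import ring lra.

Set Implicit Arguments.
Unset Strict Implicit.
Unset Printing Implicit Defensive.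

Import Order.TTheory GRing.Theory Num.Theory.
Import numFieldTopology.Exports.

Local Open Scope classical_set_scope.
Local Open Scope ring_scope.

(** The balls [rho^(n-1) + rho^n O] on which the values are prescribed are
    pairwise disjoint, since such a ball lies in the sphere of radius
    [|rho|^(n-1)]; let [gamma] be the translate of [gamma_n] on the [n]-th ball,
    and [0] elsewhere. Only the origin, where the balls accumulate, is critical
    for [gamma]; the maps [gamma^<k>] have to be found and shown to be continuous
    without completeness or local convexity of [E].

    Let [g_n] be the extension of [gamma_n] by zero from the ball [rho^n O] to
    all of [K]. Its difference quotients can be written down. If all the
    arguments lie in the ball, use [gamma_n^<k>]; if none does, take [0]; if
    [x_i] lies in the ball but [x_j] does not, divide the difference of two
    values of order [k-1] by [x_j - x_i], which has absolute value at least
    [|rho|^n] ([zero_ext]). This formula is continuous, as the ball is clopen,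
    and it shows that each step from [k-1] to [k] costs a factor [|rho|^-n] and
    one index of the calibration, both of which the decay assumption absorbs
    ([zero_ext_small]). That the result does not depend on the chosen pair
    [i], [j] is a consequence of the symmetry of Newton divided differences: at
    points with pairwise distinct coordinates every difference quotient map
    equals the Lagrange sum [divdiff] ([dquot_family_divdiff]), and such points
    are dense ([exists_close_injective]).

    The candidate for [gamma^<k>] is the sum of the translates of [g_n^<k>].
    For a fixed argument only finitely many terms are non-zero, because each
    coordinate lies in at most one of the disjoint balls; so completeness is
    not an issue. The sum converges uniformly, because
    [q_m (y_m + y_(m+1) + .. + y_n)] is at most the sum of the
    [q_(i+1) (y_i)] ([calibration_geometric_sum]); hence it is
    continuous and bounded ([series_dquot_family], [series_family_bounded]),
    and by uniqueness of difference quotients it is [gamma^<k>]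
    ([ddiff_eq]). Continuity and boundedness in [E] are tested with gauges
    throughout; there are enough of them, by a Minkowski functional argument
    ([nbhs0_gauge], [gauge_maxD]). *)

(** * Absolute values *)

Section AbsoluteValue.
Context {R : realType} {K : valuedFieldType R}.
Implicit Types x y : K.

Lemma absv0 : absv (0 : K) = 0.
Proof. exact/absv_eq0. Qed.

Lemma absv_gt0 x : x != 0 -> 0 < absv x.
Proof.
move=> x0; rewrite lt_neqAle absv_ge0 andbT eq_sym.
by apply: contra x0 => /eqP/absv_eq0 ->.
Qed.

Lemma absv1 : absv (1 : K) = 1.
Proof.
have h : absv (1 : K) != 0 by rewrite gt_eqF// absv_gt0// oner_neq0.
by apply: (mulfI h); rewrite -absvM !mulr1.
Qed.

Lemma absvX x n : absv (x ^+ n) = absv x ^+ n.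
Proof. by elim: n => [|n ih]; rewrite ?expr0 ?absv1// !exprS absvM ih. Qed.

Lemma absvV x : absv x^-1 = (absv x)^-1.
Proof.
have [->|x0] := eqVneq x 0; first by rewrite invr0 absv0 invr0.
have h : absv x != 0 by rewrite gt_eqF// absv_gt0.
by apply: (mulfI h); rewrite -absvM !divff// absv1.
Qed.

Lemma absvN1 : absv (- 1 : K) = 1.
Proof.
have := absvM (-1 : K) (-1); rewrite mulrNN mulr1 absv1 -expr2 => /esym/eqP.
by rewrite sqrf_eq1 => /orP[/eqP//|/eqP h];
have := absv_ge0 (-1 : K); rewrite h; lra.
Qed.

Lemma absvN x : absv (- x) = absv x.
Proof. by rewrite -mulN1r absvM absvN1 mul1r. Qed.

Lemma absvBC x y : absv (x - y) = absv (y - x).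
Proof. by rewrite -absvN opprB. Qed.

(** If some punctured ball were empty, then all points would be isolated, by
    translation. *)
Lemma absv_small (e : R) : 0 < e -> exists2 t : K, t != 0 & absv t < e.
Proof.
move=> e0; apply: contrapT => H; apply: (@absv_nondiscrete R K) => A.
rewrite openE => x Ax; apply/nbhs_absv; exists e => // y /= yx.
suff -> : y = x by [].
apply: contrapT => /eqP yNx; apply: H; exists (x - y) => //.
by rewrite subr_eq0 eq_sym.
Qed.

Lemma near_absv (x : K) (e : R) : 0 < e -> \forall y \near x, absv (x - y) < e.
Proof. by move=> e0; apply/nbhs_absv; exists e. Qed.

Lemma absv_sub_cvg {T : Type} {F : set_system T} {FF : Filter F} (f g : T -> K)
    (a b : K) : f @ F --> a -> g @ F --> b -> f x - g x @[x --> F] --> a - b.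
Proof.
move=> fa gb A /nbhs_absv[e e0 eA]; have e20 : 0 < e / 2 by rewrite divr_gt0.
have nf : \forall x \near F, absv (a - f x) < e / 2.
  exact: (fa _ (near_absv a e20)).
have ng : \forall x \near F, absv (b - g x) < e / 2.
  exact: (gb _ (near_absv b e20)).
rewrite nbhs_filterE /=; apply: filterS2 nf ng => x fx gx; apply: eA => /=.
have -> : a - b - (f x - g x) = (a - f x) + - (b - g x) by ring.
by rewrite [e]splitr (le_lt_trans (absvD _ _))// absvN ltrD.
Qed.

Lemma absvV_continuous x : x != 0 -> {for x, continuous (fun y => y^-1)}.
Proof.
move=> x0 A /nbhs_absv[e e0 eA]; have p0 := absv_gt0 x0.
have d0 : 0 < Num.min (absv x / 2) (e * absv x ^+ 2 / 2).
  by rewrite lt_min !(mulr_gt0, exprn_gt0, divr_gt0)//.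
change (nbhs x (fun y => A y^-1)); apply/nbhs_absv.
exists (Num.min (absv x / 2) (e * absv x ^+ 2 / 2)) => // y /=.
rewrite lt_min => /andP[h1 h2]; apply: eA => /=.
have hy : absv x / 2 < absv y.
  have := absvD (x - y) y; rewrite subrK; move: h1.
  by set a := absv x; set b := absv y; set c := absv (x - y); lra.
have y0 : y != 0.
  by apply/eqP => y0; move: hy; rewrite y0 absv0; lra.
have -> : x^-1 - y^-1 = (y - x) / (x * y).
  by field; rewrite y0.
rewrite absvM absvV absvM absvBC ltr_pdivrMr ?mulr_gt0 ?absv_gt0//.
rewrite (lt_trans h2)// -mulrA ltr_pM2l// expr2 -mulrA ltr_pM2l//.
Qed.

End AbsoluteValue.
Arguments absv_small {R} K [e].

(** * Gauges describe the topology *)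

Section Gauges.
Context {R : realType} {K : valuedFieldType R} {E : valuedTvsType K}.
Implicit Types (q : E -> R) (x y v : E) (W V : set E).

Lemma scale_cvg {T : Type} {F : set_system T} {FF : Filter F} (f : T -> K)
    (g : T -> E) (a : K) (b : E) :
  f @ F --> a -> g @ F --> b -> f x *: g x @[x --> F] --> a *: b.
Proof.
move=> fa gb.
by apply: (continuous2_cvg _ _ fa gb); exact: (vscale_continuous (a, b)).
Qed.

Lemma add_cvg {T : Type} {F : set_system T} {FF : Filter F} (f g : T -> E)
    (a b : E) :
  f @ F --> a -> g @ F --> b -> f x + g x @[x --> F] --> a + b.
Proof.
move=> fa gb.
by apply: (continuous2_cvg _ _ fa gb); exact: (vadd_continuous (a, b)).
Qed.

Lemma opp_cvg {T : Type} {F : set_system T} {FF : Filter F} (f : T -> E)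
    (a : E) : f @ F --> a -> - f x @[x --> F] --> - a.
Proof.
move=> fa; rewrite -scaleN1r; under eq_fun do rewrite -scaleN1r.
by apply: scale_cvg fa; exact: cvg_cst.
Qed.

Lemma sub_cvg {T : Type} {F : set_system T} {FF : Filter F} (f g : T -> E)
    (a b : E) :
  f @ F --> a -> g @ F --> b -> f x - g x @[x --> F] --> a - b.
Proof. by move=> fa gb; apply: add_cvg fa _; exact: opp_cvg. Qed.

Lemma gauge0 q : gauge q -> q 0 = 0.
Proof. by case=> _ h _; rewrite -(scale0r 0) h absv0 mul0r. Qed.

Lemma gaugeN q x : gauge q -> q (- x) = q x.
Proof. by case=> _ h _; rewrite -scaleN1r h absvN1 mul1r. Qed.

Definition balanced V := forall (t : K) x, absv t <= 1 -> V x -> V (t *: x).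

(** By continuity of scalar multiplication at [(0, 0)] some set [t B] with
    [|t|] ranging over a ball lands in [W]; the union of these sets is balanced. *)
Lemma nbhs_balanced W : nbhs 0 W ->
  exists V, [/\ nbhs 0 V, balanced V & V `<=` W].
Proof.
move=> W0.
have : \forall z \near ((0 : K), (0 : E)), W (z.1 *: z.2).
  have := vscale_continuous ((0 : K), (0 : E)) => /=.
  by rewrite /continuous_at /= scaler0 => h; exact: h.
case=> -[A B] /= [/nbhs_absv[e e0 eA] B0] AB.
have [s s0 se] := absv_small K e0.
exists [set x | exists t : K, absv t < e /\ exists2 b, B b & x = t *: b].
split => [|t _ t1 [u [ue [b Bb ->]]]|_ [t [te [b Bb ->]]]].
- have : \forall x \near (0 : E), B (s^-1 *: x).
    have h : (fun x : E => s^-1 *: x) @ (0 : E) --> s^-1 *: (0 : E).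
      by apply: scale_cvg; [exact: cvg_cst | exact: cvg_id].
    by apply: h; rewrite scaler0.
  apply: filterS => x Bx /=; exists s; split=> //; exists (s^-1 *: x) => //.
  by rewrite scalerA divff// scale1r.
- exists (t * u); split; last by exists b => //; rewrite scalerA.
  by rewrite absvM (le_lt_trans _ ue)// ler_piMl ?absv_ge0.
- apply: (AB (t, b)); split => //=; apply: eA.
  by rewrite /= sub0r absvN.
Qed.

(** The infimum ranges over the values [|t|] only, so that the homogeneity
    [q (t x) = |t| q x] is exact even if the value group is discrete. *)
Definition minkowski V x : R :=
  inf [set r | exists t : K, [/\ t != 0, V (t^-1 *: x) & r = absv t]].

Section Minkowski.
Variables (V : set E) (V0 : nbhs 0 V) (balV : balanced V).

Lemma minkowski_has_inf x :
  has_inf [set r | exists t : K, [/\ t != 0, V (t^-1 *: x) & r = absv t]].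
Proof.
split; last by exists 0 => _ [t [_ _ ->]]; exact: absv_ge0.
have h : (fun s : K => s *: x) @ (0 : K) --> (0 : K) *: x.
  by apply: scale_cvg; [exact: cvg_id | exact: cvg_cst].
have : \forall s \near (0 : K), V (s *: x) by apply: h; rewrite scale0r.
move=> /nbhs_absv[e e0 eV]; have [s s0 se] := absv_small K e0.
exists (absv s^-1); exists s^-1; split=> //; first exact: invr_neq0.
by rewrite invrK; apply: eV; rewrite /= sub0r absvN.
Qed.

Lemma minkowski_le t x : t != 0 -> V (t^-1 *: x) -> minkowski V x <= absv t.
Proof.
by move=> t0 Vx; apply: ge_inf; [case: (minkowski_has_inf x)|exists t].
Qed.

Lemma minkowski_adherent x r : minkowski V x < r ->
  exists t : K, [/\ t != 0, V (t^-1 *: x) & absv t < r].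
Proof.
move=> h; have e0 : 0 < r - minkowski V x by rewrite subr_gt0.
have [_ [t [t0 Vt ->]]] := inf_adherent e0 (minkowski_has_inf x).
by rewrite addrC subrK => tr; exists t.
Qed.

Lemma minkowski_ge0 x : 0 <= minkowski V x.
Proof.
apply: lb_le_inf; first by case: (minkowski_has_inf x).
by move=> _ [t [_ _ ->]]; exact: absv_ge0.
Qed.

Lemma minkowskiZ_le s x : s != 0 ->
  minkowski V (s *: x) <= absv s * minkowski V x.
Proof.
move=> s0; rewrite leNgt; apply/negP; rewrite mulrC -ltr_pdivlMr ?absv_gt0//.
move=> /minkowski_adherent[t [t0 Vt]]; rewrite ltr_pdivlMr ?absv_gt0//.
rewrite -absvM ltNge => /negP; apply; apply: minkowski_le.
  by rewrite mulf_neq0.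
by rewrite invfM scalerA -mulrA mulVf// mulr1.
Qed.

Lemma minkowski_gauge : gauge (minkowski V).
Proof.
have m0 : minkowski V 0 = 0.
  apply/eqP; rewrite eq_le minkowski_ge0 andbT leNgt; apply/negP => h.
  have [t t0] := absv_small K h; rewrite ltNge => /negP; apply.
  by apply: minkowski_le; rewrite // scaler0; exact: nbhs_singleton.
split=> [|t x|r r0]; first exact: minkowski_ge0.
- have [->|t0] := eqVneq t 0; first by rewrite scale0r absv0 mul0r.
  apply/eqP; rewrite eq_le minkowskiZ_le//=.
  have := minkowskiZ_le (t *: x) (invr_neq0 t0).
  by rewrite scalerA mulVf// scale1r absvV mulrC ler_pdivlMr ?absv_gt0// mulrC.
- have [s s0 sr] := absv_small K r0.
  have h : (fun x : E => s^-1 *: x) @ (0 : E) --> s^-1 *: (0 : E).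
    by apply: scale_cvg; [exact: cvg_cst | exact: cvg_id].
  have : \forall x \near (0 : E), V (s^-1 *: x) by apply: h; rewrite scaler0.
  apply: filterS => x Vx /=; apply: le_lt_trans sr; exact: minkowski_le.
Qed.

Lemma minkowski_lt1 x : minkowski V x < 1 -> V x.
Proof.
move=> /minkowski_adherent[t [t0 Vx /ltW t1]].
by rewrite -(scale1r x) -(divff t0) -scalerA; exact: balV.
Qed.

Lemma minkowski_add q x y : gauge q ->
  (forall u v, V u -> V v -> q (u + v) < 1) ->
  q (x + y) <= Num.max (minkowski V x) (minkowski V y).
Proof.
move=> [_ qZ _] qV; rewrite leNgt; apply/negP; rewrite gt_max => /andP[].
move=> /minkowski_adherent[s [s0 Vs sr]] /minkowski_adherent[t [t0 Vt tr]].
wlog st : x y s t s0 Vs sr t0 Vt tr / absv s <= absv t.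
  move=> H; have [st|/ltW ts] := leP (absv s) (absv t); first exact: (H x y s t).
  by apply: (H y x t s); rewrite // addrC.
have Vtx : V (t^-1 *: x).
  have -> : t^-1 *: x = (t^-1 * s) *: (s^-1 *: x).
    by rewrite scalerA -mulrA divff// mulr1.
  apply: balV => //; rewrite absvM absvV mulrC.
  by rewrite ler_pdivrMr ?absv_gt0// mul1r.
have := qV _ _ Vtx Vt; rewrite -scalerDr qZ absvV mulrC ltr_pdivrMr ?absv_gt0//.
by rewrite mul1r => h; have := lt_trans tr h; rewrite ltxx.
Qed.

End Minkowski.

(** This replaces the triangle inequality. If [V + V] lies in [{q < 1}] and
    [x], [y] are in [s V], [t V], then both are in the larger of these two sets
    as [V] is balanced; so a maximum suffices on the right, instead of a sum. *)
Lemma gauge_maxD q : gauge q ->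
  exists2 q' : E -> R, gauge q' &
    forall x y, q (x + y) <= Num.max (q' x) (q' y).
Proof.
move=> gq; have [_ _ q0] := gq.
have : \forall z \near ((0 : E), (0 : E)), q (z.1 + z.2) < 1.
  have := vadd_continuous ((0 : E), (0 : E)).
  by rewrite /continuous_at /= addr0 => /(_ _ (q0 1 ltr01)).
case=> -[A B] /= [A0 B0] AB.
have [V [V0 balV VAB]] := nbhs_balanced (filterI A0 B0).
exists (minkowski V); first exact: minkowski_gauge.
move=> x y; apply: minkowski_add => // u v /VAB[Au _] /VAB[_ Bv].
exact: (AB (u, v)).
Qed.

Lemma nbhs0_gauge W : nbhs 0 W ->
  exists2 q, gauge q & [set x | q x < 1] `<=` W.
Proof.
move=> /nbhs_balanced[V [V0 balV VW]]; exists (minkowski V).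
  exact: minkowski_gauge.
by move=> x /= /minkowski_lt1 => /(_ V0 balV); exact: VW.
Qed.

Lemma nbhs_gauge x W : nbhs x W <->
  exists2 q, gauge q & [set y | q (y - x) < 1] `<=` W.
Proof.
split => [xW|[q [_ _ q0] qW]].
  have : \forall y \near (0 : E), W (y + x).
    have h : (fun y : E => y + x) @ (0 : E) --> (0 : E) + x.
      by apply: add_cvg; [exact: cvg_id | exact: cvg_cst].
    by apply: h; rewrite add0r.
  move=> /nbhs0_gauge[q gq qW]; exists q => // y /= /qW.
  by rewrite subrK.
have h : (fun y : E => y - x) @ x --> x - x.
  by apply: sub_cvg; [exact: cvg_id | exact: cvg_cst].
have : \forall y \near x, q (y - x) < 1.
  by apply: (h [set y | q y < _]); rewrite subrr; exact: q0.
exact: filterS.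
Qed.

Lemma near_gauge q x (e : R) : gauge q -> 0 < e ->
  \forall y \near x, q (y - x) < e.
Proof.
move=> [_ _ q0] e0.
have h : (fun y : E => y - x) @ x --> x - x.
  by apply: sub_cvg; [exact: cvg_id | exact: cvg_cst].
by apply: (h [set y | q y < _]); rewrite subrr; exact: q0.
Qed.

Lemma cvg_gauge {T : Type} {F : set_system T} {FF : Filter F} (f : T -> E) a :
  (forall q, gauge q -> forall e : R, 0 < e ->
    \forall x \near F, q (f x - a) < e) -> f @ F --> a.
Proof.
move=> h A /nbhs_gauge[q gq qA].
by apply: filterS (h q gq 1 ltr01) => x; exact: qA.
Qed.

Lemma gauge_eq0 (hE : hausdorff_space E) x :
  (forall q, gauge q -> q x = 0) -> x = 0.
Proof.
move=> h; apply/esym/hE => A B /nbhs_gauge[q gq qA] xB.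
exists x; split; last exact: nbhs_singleton.
by apply: qA; rewrite /= subr0 h.
Qed.

(** If [t A] lies in [{q < 1}] for some [t != 0], then [q] is at most [1 / |t|]
    on [A]; conversely the unit balls of gauges are arbitrarily small by
    [nbhs0_gauge]. *)
Lemma tvs_boundedP (A : set E) :
  tvs_bounded A <-> forall q, gauge q -> exists C : R, forall x, A x -> q x <= C.
Proof.
split=> [bA q [q0 qZ qn]|h W /nbhs0_gauge[q gq qW]].
  have [V /nbhs_absv[e e0 eV] VA] := bA _ (qn 1 ltr01).
  have [t t0 te] := absv_small K e0; exists (absv t)^-1 => x Ax.
  have /= := VA t x (eV t _) Ax; rewrite /= sub0r absvN => /(_ te).
  by rewrite qZ mulrC -ltr_pdivlMr ?absv_gt0// mul1r => /ltW.
have [C AC] := h q gq; have [q0 qZ _] := gq.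
have C0 : 0 < `|C| + 1 by rewrite ltr_wpDl.
exists [set t : K | absv t < (`|C| + 1)^-1].
  apply/nbhs_absv; exists (`|C| + 1)^-1; first by rewrite invr_gt0.
  by move=> t /=; rewrite sub0r absvN.
move=> t x /= tC Ax; apply: qW; rewrite /= qZ.
rewrite (@le_lt_trans _ _ (absv t * (`|C| + 1)))//; last first.
  by rewrite -ltr_pdivlMr// mul1r.
rewrite ler_wpM2l ?absv_ge0// (le_trans (AC _ Ax))// (le_trans (ler_norm C))//.
by rewrite lerDl.
Qed.

End Gauges.

(** * Divided differences at distinct points *)

Section DividedDifferences.
Context {R : realType} {K : valuedFieldType R} {E : valuedTvsType K}.
Implicit Types (f : K -> E) (s t : seq K).

(** The Lagrange form of the Newton divided difference [f[s]]. Taking a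
    sequence as argument makes symmetry a statement about permutations. *)
Definition divdiff f s : E :=
  \sum_(a <- s) (\prod_(b <- s | b != a) (a - b))^-1 *: f a.

Lemma eq_mem_divdiff f s t : uniq s -> uniq t -> s =i t ->
  divdiff f s = divdiff f t.
Proof.
move=> us ut st; have p := uniq_perm us ut st.
by rewrite /divdiff (perm_big _ p); apply: eq_bigr => a _; rewrite (perm_big _ p).
Qed.

(** Termwise, this is the partial fraction decomposition of
    [1 / ((c - a) (c - b))]. *)
Lemma divdiff_cons2 f a b s : uniq [:: a, b & s] ->
  divdiff f [:: a, b & s] =
  (b - a)^-1 *: (divdiff f (b :: s) - divdiff f (a :: s)).
Proof.
rewrite /= inE negb_or => /and3P[/andP[ab aNs] bNs us].
have prodN c : c \notin s ->
    \prod_(i <- s | i != c) (c - i) = \prod_(i <- s) (c - i).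
  move=> cs; rewrite big_seq_cond [RHS]big_seq; apply: eq_bigl => i.
  by case: (boolP (i \in s)) => //= si; apply: contraNneq cs => <-.
have prodC (c d : K) r : d != c -> \prod_(i <- d :: r | i != c) (c - i) =
    (c - d) * \prod_(i <- r | i != c) (c - i).
  by move=> dc; rewrite big_cons dc.
have sumE : \sum_(c <- s) (\prod_(i <- [:: a, b & s] | i != c) (c - i))^-1 *: f c
    = (b - a)^-1 *:
      (\sum_(c <- s) (\prod_(i <- b :: s | i != c) (c - i))^-1 *: f c -
       \sum_(c <- s) (\prod_(i <- a :: s | i != c) (c - i))^-1 *: f c).
  rewrite -sumrB scaler_sumr big_seq [RHS]big_seq; apply: eq_bigr => c cs.
  have ac : a != c by apply: contraNneq aNs => ->.
  have bc : b != c by apply: contraNneq bNs => ->.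
  rewrite !prodC// -scalerBl scalerA !invfM; congr (_ *: _).
  set p := (\prod_(i <- s | i != c) (c - i))^-1; field.
  by rewrite !subr_eq0 !(eq_sym c) ac bc eq_sym ab.
rewrite /divdiff [LHS]big_cons [X in _ + X]big_cons sumE.
rewrite [\sum_(_ <- b :: s) _]big_cons [\sum_(_ <- a :: s) _]big_cons.
rewrite ![\prod_(i <- _ :: _ | i != a) _]big_cons !eqxx /= (eq_sym b a) ab.
rewrite ![\prod_(i <- _ :: _ | i != b) _]big_cons !eqxx /= ab.
rewrite !prodN//. rewrite opprD addrACA [RHS]scalerDr addrA; congr (_ + _).
by rewrite scalerDr !invfM -!scalerA addrC; congr (_ + _);
  rewrite scalerN -scaleNr -invrN opprB.
Qed.

(** By symmetry the recursion may use any two points, not only the first and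
    the last one. *)
Lemma divdiff_rem f s a b : uniq s -> a \in s -> b \in s -> a != b ->
  divdiff f s = (b - a)^-1 *: (divdiff f (rem a s) - divdiff f (rem b s)).
Proof.
move=> us sa sb ab; pose t := [seq c <- s | (c != a) && (c != b)].
have ut : uniq t by rewrite filter_uniq.
have aNt : a \notin t by rewrite mem_filter eqxx.
have bNt : b \notin t by rewrite mem_filter eqxx andbF.
rewrite (@eq_mem_divdiff _ s [:: a, b & t])//; first last.
- move=> c; rewrite !inE mem_filter.
  have [->|ca] /= := eqVneq c a; first by rewrite sa.
  by have [->|cb] /= := eqVneq c b.
- by rewrite /= inE negb_or ab aNt bNt ut.
rewrite divdiff_cons2; last by rewrite /= inE negb_or ab aNt bNt ut.
congr (_ *: (_ - _)); apply: eq_mem_divdiff; rewrite ?rem_uniq//= ?aNt ?bNt//.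
- move=> c; rewrite inE mem_filter mem_rem_uniq// inE.
  have [->|cb] /= := eqVneq c b; first by rewrite eq_sym ab sb.
  by rewrite andbT.
- move=> c; rewrite inE mem_filter mem_rem_uniq// inE.
  by have [->|ca] /= := eqVneq c a; first by rewrite ab sa.
Qed.

Definition points n (x : 'rV[K]_n) : seq K := [seq x 0 i | i <- enum 'I_n].

Lemma mem_points n (x : 'rV[K]_n) i : x 0 i \in points x.
Proof. by apply: map_f; rewrite mem_enum. Qed.

Lemma pointsP n (x : 'rV[K]_n) c :
  reflect (exists i, c = x 0 i) (c \in points x).
Proof.
by apply: (iffP mapP) => [[i _ ->]|[i ->]]; exists i; rewrite ?mem_enum.
Qed.

Lemma uniq_points n (x : 'rV[K]_n) : injective (x 0) -> uniq (points x).
Proof. by move=> xi; rewrite map_inj_uniq// enum_uniq. Qed.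

Lemma injective_col' n (x : 'rV[K]_n.+1) i :
  injective (x 0) -> injective (col' i x 0).
Proof. by move=> xi a b; rewrite !mxE => /xi/lift_inj. Qed.

Lemma points_col' n (x : 'rV[K]_n.+1) i : injective (x 0) ->
  points (col' i x) =i rem (x 0 i) (points x).
Proof.
move=> xi c; rewrite mem_rem_uniq ?uniq_points// inE.
apply/pointsP/andP => [[l ->]|[+ /pointsP[l cl]]].
  rewrite mxE mem_points; split=> //.
  by apply/negP => /eqP/xi/eqP; rewrite eq_sym (negbTE (neq_lift _ _)).
rewrite cl => xil; have il : i != l by apply: contra xil => /eqP ->.
by have [l' ll' _] := unlift_some il; exists l'; rewrite mxE -ll'.
Qed.

Lemma divdiff_col' f n (x : 'rV[K]_n.+2) i j : injective (x 0) -> i != j ->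
  divdiff f (points x) = (x 0 j - x 0 i)^-1 *:
    (divdiff f (points (col' i x)) - divdiff f (points (col' j x))).
Proof.
move=> xi ij.
rewrite (@divdiff_rem _ _ (x 0 i) (x 0 j)) ?mem_points ?uniq_points//; last first.
  by apply: contra ij => /eqP/xi ->.
by congr (_ *: (_ - _)); apply: eq_mem_divdiff;
  rewrite ?rem_uniq ?uniq_points//; try (exact: injective_col');
  move=> c; rewrite points_col'.
Qed.

Lemma row_init_col' k (x : 'rV[K]_k.+2) : row_init x = col' ord_max x.
Proof.
apply/rowP => i; rewrite !mxE; congr (x 0 _); apply: val_inj.
by rewrite /= /bump leqNgt ltn_ord.
Qed.

Lemma row_swapE k (x : 'rV[K]_k.+2) i : row_swap x 0 i =
  x 0 (if i == ord0 then ord_max else widen_ord (leqnSn k.+1) i).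
Proof. by rewrite !mxE; case: ifP. Qed.

Lemma injective_row_swap k (x : 'rV[K]_k.+2) :
  injective (x 0) -> injective (row_swap x 0).
Proof.
move=> xi a b; rewrite !row_swapE => /xi.
have wmax (i : 'I_k.+1) : widen_ord (leqnSn k.+1) i = ord_max -> False.
  by move=> /(congr1 val) /= h; have := ltn_ord i; rewrite h ltnn.
case: eqVneq => [->|_]; case: eqVneq => [->|_] //.
- by move/esym/wmax.
- by move/wmax.
- by move=> /(congr1 val) /= ab; apply: val_inj.
Qed.

Lemma points_row_swap k (x : 'rV[K]_k.+2) :
  points (row_swap x) =i points (col' ord0 x).
Proof.
move=> c; apply/pointsP/pointsP => -[i ->].
- rewrite row_swapE; case: eqVneq => [_|i0].
    by exists ord_max; rewrite mxE; congr (x 0 _); apply: val_inj.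
  exists (inord i.-1); rewrite mxE; congr (x 0 _); apply: val_inj => /=.
  rewrite inordK; last by rewrite (leq_ltn_trans (leq_pred _)).
  by rewrite /bump leq0n add1n prednK// lt0n.
- rewrite mxE; have [->|im] := eqVneq i ord_max.
    by exists ord0; rewrite row_swapE eqxx; congr (x 0 _); apply: val_inj.
  have ik : (i < k)%N by rewrite ltn_neqAle im -ltnS ltn_ord.
  exists (Ordinal (ik : (i.+1 < k.+1)%N)); rewrite row_swapE /=.
  by congr (x 0 _); apply: val_inj.
Qed.

Lemma divdiff_swap_init f k (x : 'rV[K]_k.+2) : injective (x 0) ->
  divdiff f (points x) = (x 0 ord_max - x 0 ord0)^-1 *:
    (divdiff f (points (row_swap x)) - divdiff f (points (row_init x))).
Proof.
move=> xi; rewrite (@divdiff_col' f _ x ord0 ord_max)// row_init_col'.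
congr (_ *: (_ - _)); apply: eq_mem_divdiff.
- exact/uniq_points/injective_col'.
- exact/uniq_points/injective_row_swap.
- by move=> c; rewrite points_row_swap.
Qed.

Lemma rpow_row_swap (U : set K) k (x : 'rV[K]_k.+2) :
  rpow U k.+2 x -> rpow U k.+1 (row_swap x).
Proof. by move=> Ux i; rewrite row_swapE. Qed.

Lemma rpow_row_init (U : set K) k (x : 'rV[K]_k.+2) :
  rpow U k.+2 x -> rpow U k.+1 (row_init x).
Proof. by move=> Ux i; rewrite mxE. Qed.

(** All the maps [f^<k>] at once, given by continuous candidates; this allows
    arguing about explicit formulas instead of the choices made in [ddiff]. *)
Definition dquot_family (U : set K) f (h : forall k, 'rV[K]_k.+1 -> E) :=
  [/\ forall x, rpow U 1 x -> h 0%N x = f (x 0 0),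
      {within rpow U 1, continuous (h 0%N)} &
      forall k, is_dquot U (h k) (h k.+1)].

(** Unfolding the recursion is possible because distinct coordinates never
    lead to a vanishing denominator. *)
Lemma dquot_family_divdiff U f h k x : dquot_family U f h ->
  rpow U k.+1 x -> injective (x 0) -> h k x = divdiff f (points x).
Proof.
move=> [h0 _ hS]; elim: k x => [|k ih] x Ux xi.
  rewrite h0// /divdiff /points enum_ordSl enum_ord0 /= big_seq1 big_cons eqxx.
  by rewrite big_nil invr1 scale1r.
have [_ ->//] := hS k; last by apply/eqP => /xi.
rewrite (divdiff_swap_init _ xi) (ih _ (rpow_row_swap Ux)).
rewrite 1?(ih _ (rpow_row_init Ux))//.
  by rewrite row_init_col'; exact: injective_col'.
exact: injective_row_swap.
Qed.

Lemma dquot_family_continuous U f h k : dquot_family U f h ->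
  {within rpow U k.+1, continuous (h k)}.
Proof. by case=> _ h0 hS; case: k => // k; case: (hS k). Qed.

End DividedDifferences.

(** * Density of distinct points and uniqueness *)

Section Rows.
Context {R : realType} {K : valuedFieldType R} {E : valuedTvsType K}.

Lemma entry_continuous m n i j : continuous (fun x : 'M[K]_(m, n) => x i j).
Proof.
move=> x A xA; exists (fun i' j' => if (i' == i) && (j' == j) then A else setT).
  move=> i' j'; case: ifP => [/andP[/eqP -> /eqP ->]//|_]; exact: filterT.
by move=> y /= /(_ i j); rewrite !eqxx.
Qed.

Lemma cvg_entries {T : Type} {F : set_system T} {FF : Filter F} m n
    (f : T -> 'M[K]_(m, n)) (a : 'M[K]_(m, n)) :
  (forall i j, f x i j @[x --> F] --> a i j) -> f @ F --> a.
Proof.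
move=> fa A [P aP PA]; rewrite nbhs_filterE /=.
have : \forall x \near F, forall i j, P i j (f x i j).
  apply: filter_forall => i; apply: filter_forall => j.
  by apply: fa; exact: aP.
by apply: filterS => x Px; apply: PA.
Qed.

Lemma reindex_continuous m n (phi : 'rV[K]_m -> 'rV[K]_n) (g : 'I_n -> 'I_m) :
  (forall x i, phi x 0 i = x 0 (g i)) -> continuous phi.
Proof.
move=> phiE a; have FF : Filter (nbhs (a : 'rV[K]_m)) by exact: nbhs_filter.
apply: (@cvg_entries _ _ FF) => i j; rewrite ord1.
under eq_fun do rewrite phiE.
by rewrite phiE; exact: entry_continuous.
Qed.

(** Perturb the coordinate [x_i] by [t p^i] with [0 < |p| < 1]. The powers of
    [p] are distinct, so for each pair [i], [j] at most one non-zero [t]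
    makes the coordinates collide; all small [t != 0] work. *)
Lemma exists_close_injective n (x : 'rV[K]_n) (A : set 'rV[K]_n) :
  nbhs x A -> exists2 y, A y & injective (y 0).
Proof.
move=> xA; have [p p0 p1] := absv_small K (ltr01 : 0 < 1 :> R).
have pX_inj (i j : nat) : i != j -> p ^+ i - p ^+ j != 0.
  apply: contra; rewrite subr_eq0 => /eqP/(congr1 absv); rewrite !absvX.
  by move=> /ieexprIn/eqP; apply; rewrite ?absv_gt0// lt_eqF.
pose y (t : K) : 'rV[K]_n := \row_i (x 0 i + t * p ^+ i).
have yx : y @ (0 : K) --> x.
  apply: cvg_entries => i j; rewrite ord1 => B /nbhs_absv[e e0 eB].
  apply/nbhs_absv; exists e => // t /=; rewrite sub0r absvN => te; apply: eB.
  rewrite /= mxE opprD addrA subrr sub0r absvN absvM absvX (le_lt_trans _ te)//.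
  by rewrite ler_piMr ?absv_ge0// exprn_ile1 ?absv_ge0// ltW.
have yi : \forall t \near (0 : K), forall i j, t != 0 -> y t 0 i = y t 0 j -> i = j.
  apply: filter_forall => i; apply: filter_forall => j.
  have [->|ij] := eqVneq i j; first exact: nearW.
  have pij := pX_inj _ _ ij.
  have [xij|xij] := eqVneq (x 0 i) (x 0 j).
    apply: nearW => t t0; rewrite !mxE xij => /addrI/(mulfI t0)/eqP.
    by rewrite -subr_eq0 (negbTE pij).
  (* the only value of the parameter for which the two coordinates agree *)
  pose t1 := - ((x 0 i - x 0 j) / (p ^+ i - p ^+ j)).
  have t10 : t1 != 0 by rewrite oppr_eq0 mulf_neq0 ?invr_eq0// subr_eq0.
  apply/nbhs_absv; exists (absv t1); first exact: absv_gt0.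
  move=> t /=; rewrite sub0r absvN => tt1 _; rewrite !mxE => yij.
  suff tE : t = t1 by rewrite tE ltxx in tt1.
  apply: (mulIf pij); rewrite mulNr divfK//; apply/eqP; rewrite -subr_eq0.
  have -> : t * (p ^+ i - p ^+ j) - - (x 0 i - x 0 j) =
      (x 0 i + t * p ^+ i) - (x 0 j + t * p ^+ j) by ring.
  by rewrite yij subrr.
have yA : \forall t \near (0 : K), A (y t) := yx _ xA.
have [e e0 he] := iffLR (nbhs_absv _ _) (filterI yA yi).
have [t t0 te] := absv_small K e0.
have [] := he t; first by rewrite /= sub0r absvN.
by move=> At ti; exists (y t) => // i j; exact: ti.
Qed.

Lemma eq_on_injective (hE : hausdorff_space E) n (f g : 'rV[K]_n -> E) :
  continuous f -> continuous g ->
  (forall x : 'rV_n, injective (x 0) -> f x = g x) -> f = g.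
Proof.
move=> cf cg fg; apply/funext => x; apply/eqP; rewrite -subr_eq0; apply/eqP.
apply: (gauge_eq0 hE) => q gq; apply/eqP; rewrite eq_le; have [-> _ _] := gq.
rewrite andbT leNgt; apply/negP => e0.
have [q' gq' qq'] := gauge_maxD gq.
have nf : \forall y \near x, q' (f y - f x) < q (f x - g x).
  exact: (cf x _ (near_gauge (f x) gq' e0)).
have ng : \forall y \near x, q' (g y - g x) < q (f x - g x).
  exact: (cg x _ (near_gauge (g x) gq' e0)).
have [y [yf yg] yi] := exists_close_injective (filterI nf ng).
have fgE : f x - g x = - (f y - f x) + (g y - g x).
  by rewrite (fg y yi) opprB addrA subrK.
have := qq' (- (f y - f x)) (g y - g x); rewrite -fgE leNgt => /negP; apply.
by rewrite gt_max gaugeN//; apply/andP; split.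
Qed.

(** Two candidates agree at points with distinct coordinates, hence
    everywhere by density, as [E] is Hausdorff. *)
Lemma ddiff_eq (hE : hausdorff_space E) (f : K -> E) h :
  dquot_family setT f h -> forall k, ddiff setT f k = h k.
Proof.
move=> fh; have [h0 _ hS] := fh; elim=> [|k ih].
  by apply/funext => x; rewrite h0.
rewrite /= ih; have := xgetPex (fun=> 0) (ex_intro _ _ (hS k) :
  exists g, [set g | is_dquot setT (h k) g] g).
set g := xget _ _ => -[cg gE]; have [ch hE'] := hS k.
have TT n : rpow [set: K] n = setT by rewrite eqEsubset; split.
rewrite TT -continuous_subspace_setT in cg.
rewrite TT -continuous_subspace_setT in ch.
apply: eq_on_injective => // x xi.
have x0 : x 0 ord0 != x 0 ord_max by apply/eqP => /xi.
by rewrite gE// hE'.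
Qed.

Lemma dquot_family_smooth (hE : hausdorff_space E) (f : K -> E) h :
  dquot_family setT f h -> smooth setT f.
Proof.
move=> fh k; have [h0 c0 hS] := fh; elim: k => [|k ih] /=.
  have TT : rpow [set: K] 1 = setT by rewrite eqEsubset; split.
  rewrite TT -continuous_subspace_setT in c0.
  apply: continuous_subspaceT => t.
  have fE : f = h 0%N \o const_mx.
    by apply/funext => s; rewrite /= h0// mxE.
  rewrite fE; apply: continuous_comp; last exact: c0.
  by apply: cvg_entries => i j; under eq_fun do rewrite mxE; rewrite mxE.
by split=> //; exists (h k.+1); rewrite (ddiff_eq hE fh).
Qed.

Lemma smooth_dquot_family (U : set K) (f : K -> E) :
  smooth U f -> dquot_family U f (ddiff U f).
Proof.
move=> sf; split=> //=.
- apply/subspace_continuousP => x Ux.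
  have := sf 0%N; rewrite /= => /subspace_continuousP/(_ (x 0 0) (Ux _)) fx.
  move=> A /fx fA; have {}fA : \forall t \near x 0 0, U t -> A (f t) by [].
  have xA : nbhs x (fun y : 'rV[K]_1 => U (y 0 0) -> A (f (y 0 0))) :=
    @entry_continuous 1 1 0 0 x _ fA.
  change (nbhs x (fun y : 'rV[K]_1 => rpow U 1 y -> A (f (y 0 0)))).
  by apply: filterS xA => y yA Uy; apply: yA.
- move=> k; have [_ ex] := sf k.+1.
  exact: (xgetPex (fun=> 0) (ex : exists g, [set g | is_dquot U _ g] g)).
Qed.

End Rows.

(** * Extension by zero from a clopen set *)

Section Extension.
Context {R : realType} {K : valuedFieldType R} {E : valuedTvsType K}.
Variables (D : set K) (delta : R) (f : K -> E)
  (h : forall k, 'rV[K]_k.+1 -> E).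
Arguments h : clear implicits.
Hypothesis delta0 : 0 < delta.
Hypothesis sepD : forall x y, D x -> ~ D y -> delta <= absv (x - y).

(** The candidate for the [k]-th difference quotient map of the extension of
    [f] by zero. The indices picked depend only on which coordinates of [x]
    lie in [D], a pattern that is locally constant. *)
Fixpoint zero_ext k : 'rV[K]_k.+1 -> E :=
  match k with
  | 0 => fun x => if x 0 0 \in D then h 0 x else 0
  | k'.+1 => fun x =>
      match [pick i | x 0 i \in D], [pick j | x 0 j \notin D] with
      | Some i, Some j =>
          (x 0 j - x 0 i)^-1 *: (zero_ext (col' i x) - zero_ext (col' j x))
      | Some _, None => h k'.+1 x
      | None, _ => 0
      end
  end.
Arguments zero_ext : clear implicits.

Lemma zero_ext_out k (x : 'rV[K]_k.+1) : (forall i, ~ D (x 0 i)) -> zero_ext k x = 0.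
Proof.
case: k x => [|k] x xD /=; first by rewrite memNset.
by case: pickP => // i; rewrite memNset.
Qed.

Lemma zero_ext_in k (x : 'rV[K]_k.+1) : rpow D k.+1 x -> zero_ext k x = h k x.
Proof.
case: k x => [|k] x xD /=; first by rewrite mem_set.
case: pickP => [i _|/(_ 0)]; last by rewrite mem_set.
by case: pickP => // j; rewrite mem_set.
Qed.

Lemma sep_in_out x y : x \in D -> y \notin D -> delta <= absv (x - y).
Proof. by move=> /set_mem xD /negP yD; apply: sepD => // /mem_set. Qed.

(** The picked indices are irrelevant at distinct points, since [divdiff_rem]
    holds for every pair of points. *)
Lemma zero_ext_divdiff k (x : 'rV[K]_k.+1) : dquot_family D f h -> injective (x 0) ->
  zero_ext k x = divdiff (patch (fun=> 0) D f) (points x).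
Proof.
move=> fh; have [h0 _ _] := fh; have hd := dquot_family_divdiff fh.
have allD n (y : 'rV_n.+1) : (forall i, y 0 i \in D) ->
    injective (y 0) -> h n y = divdiff (patch (fun=> 0) D f) (points y).
  move=> yD yi; rewrite hd//; last by move=> i; exact: set_mem.
  rewrite /divdiff big_seq [RHS]big_seq; apply: eq_bigr => _ /pointsP[i ->].
  by rewrite /patch yD.
have noD n (y : 'rV_n.+1) : (forall i, (y 0 i \in D) = false) ->
    divdiff (patch (fun=> 0) D f) (points y) = 0.
  move=> yD; rewrite /divdiff big_seq big1// => _ /pointsP[i ->].
  by rewrite /patch yD scaler0.
elim: k x => [|k ih] x xi /=.
  case: ifP => xD; first by apply: allD => // i; rewrite ord1.
  by rewrite noD// => i; rewrite ord1.
case: pickP => [i iD|xD]; last by rewrite noD.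
case: pickP => [j jD|xD]; last first.
  by apply: allD => // l; apply/negPn; rewrite xD.
rewrite (@divdiff_col' _ _ _ _ _ x i j)//; last first.
  by apply: contraNneq jD => <-.
by congr (_ *: (_ - _)); apply: ih; exact: injective_col'.
Qed.

Lemma near_mem_D (t : K) : \forall s \near t, (s \in D) = (t \in D).
Proof.
apply/nbhs_absv; exists delta => // s /= ts.
have [tD|tD] := boolP (t \in D).
  apply/negPn/negP => sD.
  by have := sep_in_out tD sD; rewrite leNgt ts.
apply/negbTE/negP => sD.
by have := sep_in_out sD tD; rewrite absvBC leNgt ts.
Qed.

Lemma near_pattern n (a : 'rV[K]_n) :
  \forall x \near a, forall i, ((x : 'rV[K]_n) 0 i \in D) = (a 0 i \in D).
Proof.
apply: (@filter_forall 'rV[K]_n 'I_n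
  (fun i x => (x 0 i \in D) = (a 0 i \in D)) (nbhs a)) => i.
exact: (@entry_continuous _ _ 1 n 0 i a _ (near_mem_D _)).
Qed.

Lemma zero_ext_continuous k : dquot_family D f h -> continuous (zero_ext k).
Proof.
move=> fh.
have hc n (a : 'rV_n.+1) : (forall i, a 0 i \in D) -> h n @ a --> h n a.
  move=> aD A hA.
  have /subspace_continuousP/(_ a (fun i => set_mem (aD i)) A hA) :=
    dquot_family_continuous (k := n) fh.
  rewrite !nbhs_filterE /= => wA.
  have {}wA : nbhs a (fun x : 'rV[K]_n.+1 => rpow D n.+1 x -> A (h n x)) by [].
  change (nbhs a (fun x : 'rV[K]_n.+1 => A (h n x))).
  apply: filterS2 wA (near_pattern a) => x xA xa; apply: xA => i.
  by apply: set_mem; rewrite xa.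
elim: k => [|k ih] a.
  have near0 : {near a,
      (fun x : 'rV[K]_1 => if a 0 0 \in D then h 0 x else 0) =1 zero_ext 0}.
    by apply: filterS (near_pattern a) => x /= ->.
  apply: cvg_trans (near_eq_cvg near0) _ => /=.
  case: ifP => aD; last exact: cvg_cst.
  by apply: hc => i; rewrite ord1.
(* near [a], the pattern of [x] may be replaced with that of [a] *)
pose G (x : 'rV[K]_k.+2) :=
  match [pick i | a 0 i \in D], [pick j | a 0 j \notin D] with
      | Some i, Some j =>
          (x 0 j - x 0 i)^-1 *: (zero_ext k (col' i x) - zero_ext k (col' j x))
      | Some _, None => h k.+1 x
      | None, _ => 0
      end.
have nearG : {near a, G =1 zero_ext k.+1}.
  apply: filterS (near_pattern a) => x xa; rewrite /G /=.
  by rewrite (eq_pick xa) (eq_pick (fun j => congr1 negb (xa j))).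
apply: cvg_trans (near_eq_cvg nearG) _.
rewrite -[zero_ext k.+1 a]/(G a) /G.
case: pickP => [i iD|aD]; last exact: cvg_cst.
case: pickP => [j jD|aD]; last first.
  by apply: hc => l; apply/negPn; rewrite aD.
have col_cvg (l : 'I_k.+2) :
    zero_ext k (col' l x) @[x --> a] --> zero_ext k (col' l a).
  apply: (@cvg_comp _ _ _ (col' l) (zero_ext k)) (ih _).
  by apply: (@reindex_continuous _ _ _ _ _ (lift l)) => x i'; rewrite mxE.
apply: scale_cvg; last exact: sub_cvg.
have ji0 : a 0 j - a 0 i != 0.
  by rewrite subr_eq0; apply: contraNneq jD => ->.
apply: (@cvg_comp _ _ _ (fun x : 'rV_k.+2 => x 0 j - x 0 i) (fun t => t^-1))
  (absvV_continuous ji0).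
by apply: absv_sub_cvg; exact: entry_continuous.
Qed.

(** The recursion through the first and the last coordinate holds at distinct
    points. After clearing the denominator both sides are continuous, so that it
    extends to all points by density. *)
Lemma zero_ext_dquot_family (hE : hausdorff_space E) : dquot_family D f h ->
  dquot_family setT (patch (fun=> 0) D f) zero_ext.
Proof.
move=> fh; split=> [x _|| k].
- rewrite (@zero_ext_divdiff 0) //; last by move=> i j _; rewrite !ord1.
  rewrite /divdiff /points enum_ordSl enum_ord0 /= big_seq1 big_cons eqxx.
  by rewrite big_nil invr1 scale1r.
- by apply: continuous_subspaceT; exact: zero_ext_continuous.
split=> [|x _ x0]; first by apply: continuous_subspaceT; exact: zero_ext_continuous.
have : (fun x : 'rV[K]_k.+2 => (x 0 ord_max - x 0 ord0) *: zero_ext k.+1 x) =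
    (fun x : 'rV[K]_k.+2 => zero_ext k (row_swap x) - zero_ext k (row_init x)).
  apply: (eq_on_injective hE) => [a|a|{x0}x xi].
  - apply: (@scale_cvg _ _ _ _ (nbhs a)); last exact: zero_ext_continuous.
    apply: (@absv_sub_cvg _ _ _ (nbhs a)); exact: entry_continuous.
  - apply: (@sub_cvg _ _ _ _ (nbhs a)).
      apply: (@continuous_comp _ _ _ (@row_swap R K k) (zero_ext k)).
        by apply: (reindex_continuous (@row_swapE R K k)).
      exact: zero_ext_continuous.
    apply: (@continuous_comp _ _ _ (@row_init R K k) (zero_ext k)).
      apply: (@reindex_continuous _ _ _ _ _ (lift ord_max)) => y i.
      by rewrite row_init_col' mxE.
    exact: zero_ext_continuous.
  have x0 : x 0 ord_max - x 0 ord0 != 0 by rewrite subr_eq0; apply/eqP => /xi.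
  have init_inj : injective (row_init x 0).
    by rewrite row_init_col'; exact: injective_col'.
  rewrite (zero_ext_divdiff fh xi) (zero_ext_divdiff fh (injective_row_swap xi)).
  rewrite (zero_ext_divdiff fh init_inj).
  by rewrite (divdiff_swap_init _ xi) scalerA divff// scale1r.
move=> /(congr1 (fun g => g x)) /= <-.
by rewrite scalerA mulVf ?scale1r// subr_eq0 eq_sym.
Qed.

Lemma zero_ext_gauge_le0 q (C : R) x : gauge q -> 0 <= C ->
  (forall y, rpow D 1 y -> q (h 0 y) <= C) -> q (zero_ext 0 x) <= C.
Proof.
move=> gq C0 hC /=; case: ifP => xD; last by rewrite gauge0.
by apply: hC => i; rewrite ord1; exact: set_mem.
Qed.

(** A pair with one point inside and one point outside of [D] is [delta] apart,
    which bounds the denominator. *)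
Lemma zero_ext_gauge_leS k q q' (C C' : R) x : gauge q ->
  (forall u v, q (u + v) <= q' u + q' v) -> gauge q' -> 0 <= C -> 0 <= C' ->
  (forall y, rpow D k.+2 y -> q (h k.+1 y) <= C) ->
  (forall y, q' (zero_ext k y) <= C') ->
  q (zero_ext k.+1 x) <= Num.max C (delta^-1 * (C' + C')).
Proof.
move=> gq qq' gq' C0 C'0 hC eC' /=; have [_ qZ _] := gq; rewrite le_max.
case: pickP => [i iD|_]; last by rewrite gauge0// C0.
case: pickP => [j jD|xD]; last first.
  rewrite hC// => l; apply: set_mem; apply/negPn; by rewrite xD.
apply/orP; right; rewrite qZ ler_pM ?absv_ge0//; first by case: gq.
- have := sep_in_out iD jD; rewrite absvBC => dij.
  rewrite absvV lef_pV2// posrE; exact: lt_le_trans dij.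
- by rewrite (le_trans (qq' _ _))// gaugeN// lerD.
Qed.

End Extension.
Arguments zero_ext {R K E} D h k _.

(** * Translates and pointwise finite series *)

Section Series.
Context {R : realType} {K : valuedFieldType R} {E : valuedTvsType K}.

Lemma dquot_family_translate (f : K -> E) h (c : K) :
  dquot_family setT f h ->
  dquot_family setT (fun t => f (t - c))
    (fun k (x : 'rV[K]_k.+1) => h k (x - const_mx c)).
Proof.
have tc n : continuous (fun x : 'rV[K]_n => x - const_mx c).
  move=> a; have FF : Filter (nbhs (a : 'rV[K]_n)) by exact: nbhs_filter.
  apply: (@cvg_entries _ _ _ _ FF) => i j; rewrite ord1 !mxE.
  under eq_fun do rewrite !mxE.
  by apply: (@absv_sub_cvg _ _ _ _ FF); [exact: entry_continuous|exact: cvg_cst].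
move=> fh; have [h0 _ hS] := fh.
have TT n : rpow [set: K] n = setT by rewrite eqEsubset; split.
have hc k : continuous (fun x : 'rV[K]_k.+1 => h k (x - const_mx c)).
  have := dquot_family_continuous (k := k) fh.
  rewrite TT -continuous_subspace_setT => ch a.
  apply: (@continuous_comp _ _ _ (fun x : 'rV[K]_k.+1 => x - const_mx c) (h k)).
    exact: tc.
  exact: ch.
split=> [x _|| k]; first by rewrite h0// !mxE.
  exact: continuous_subspaceT (hc 0%N).
split=> [|x _ x0]; first exact: continuous_subspaceT (hc k.+1).
have [_ ->//] := hS k; last by rewrite !mxE (inj_eq (addIr _)).
rewrite !mxE; have -> : x 0 ord_max - c - (x 0 ord0 - c) = x 0 ord_max - x 0 ord0.
  by ring.
congr (_ *: (h k _ - h k _)); apply/rowP => i; rewrite !mxE//.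
by case: ifP => _; rewrite ?mxE.
Qed.

Variables (f : nat -> K -> E) (h : nat -> forall k, 'rV[K]_k.+1 -> E).
Arguments h : clear implicits.
Hypothesis fh : forall i, dquot_family setT (f i) (h i).
Hypothesis h_fin : forall k (x : 'rV[K]_k.+1),
  exists N, forall i, (N <= i)%N -> h i k x = 0.
Hypothesis h_tail : forall k q, gauge q -> forall e : R, 0 < e ->
  exists N, forall M (x : 'rV[K]_k.+1), q (\sum_(N <= i < M) h i k x) < e.

Let N_ k x := projT1 (cid (@h_fin k x)).

(** As [E] need not be complete, the sum is formed by truncating at an
    index that depends on the argument, from which on all terms vanish. *)
Definition series_family k (x : 'rV[K]_k.+1) : E :=
  \sum_(0 <= i < N_ x) h i k x.
Arguments series_family : clear implicits.

Lemma series_familyE k x M : (N_ x <= M)%N ->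
  series_family k x = \sum_(0 <= i < M) h i k x.
Proof.
move=> NM; rewrite (big_cat_nat (leq0n _) NM)/=.
have -> : \sum_(N_ x <= i < M) h i k x = 0; last by rewrite addr0.
rewrite big_nat big1// => i /andP[+ _]; rewrite /N_.
by case: cid => N hN /=; exact: hN.
Qed.

Lemma series_family_eventually k x : exists N, forall M, (N <= M)%N ->
  series_family k x = \sum_(0 <= i < M) h i k x.
Proof. by exists (N_ x) => M; exact: series_familyE. Qed.

Lemma series_family_tail k q : gauge q -> forall e : R, 0 < e ->
  exists N, forall x : 'rV[K]_k.+1,
    q (series_family k x - \sum_(0 <= i < N) h i k x) < e.
Proof.
move=> gq e /(h_tail k gq)[N hN]; exists N => x.
rewrite (series_familyE (leq_maxl (N_ x) N)).
by rewrite (big_cat_nat (leq0n _) (leq_maxr _ N))//= addrAC subrr add0r.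
Qed.

(** A uniform limit of continuous maps is continuous. *)
Lemma series_family_continuous k : continuous (series_family k).
Proof.
move=> a; have FF : Filter (nbhs (a : 'rV[K]_k.+1)) by exact: nbhs_filter.
apply: (@cvg_gauge _ _ _ _ _ FF) => q gq e e0.
have [q' gq' qq'] := gauge_maxD gq; have [q2 gq2 qq2] := gauge_maxD gq'.
have [N hN] := series_family_tail k gq2 e0.
pose S (x : 'rV[K]_k.+1) := \sum_(0 <= i < N) h i k x.
have cS : S @ a --> S a.
  rewrite /S; elim: (N) => [|n ih].
    by under eq_fun do rewrite big_geq//; rewrite big_geq//; exact: cvg_cst.
  under eq_fun do rewrite big_nat_recr//=; rewrite big_nat_recr//=.
  apply: (@add_cvg _ _ _ _ _ FF) => //.
  have := dquot_family_continuous (k := k) (fh n).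
  have -> : rpow [set: K] k.+1 = setT by rewrite eqEsubset; split.
  by rewrite -continuous_subspace_setT; exact.
have nS : \forall x \near a, q' (S x - S a) < e.
  exact: (cS _ (near_gauge (S a) gq' e0)).
apply: filterS nS => x Sx.
have -> : series_family k x - series_family k a = (S x - S a) +
    ((series_family k x - S x) + - (series_family k a - S a)).
  by rewrite opprB addrACA [S x + _]addrC subrK addKr.
rewrite (le_lt_trans (qq' _ _))// gt_max Sx /=.
by rewrite (le_lt_trans (qq2 _ _))// gt_max gaugeN// !hN.
Qed.

Lemma series_dquot_family :
  dquot_family setT (fun t => series_family 0 (const_mx t)) series_family.
Proof.
split=> [x _||k].
- by congr (series_family 0 _); apply/rowP => i; rewrite mxE ord1.
- by apply: continuous_subspaceT; exact: series_family_continuous.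
split=> [|x Ux x0].
  by apply: continuous_subspaceT; exact: series_family_continuous.
pose M := maxn (N_ x) (maxn (N_ (row_swap x)) (N_ (row_init x))).
rewrite (@series_familyE _ x M) ?leq_maxl//.
rewrite (@series_familyE _ (row_swap x) M); last first.
  by rewrite /M maxnCA leq_maxl.
rewrite (@series_familyE _ (row_init x) M); last first.
  by rewrite /M maxnA leq_maxr.
rewrite -sumrB scaler_sumr; apply: eq_bigr => i _.
by have [_ _ hS] := fh i; have [_ ->] := hS k.
Qed.

(** The series differs from one of its bounded partial sums by a uniformly
    small error. *)
Lemma series_family_bounded k :
  (forall i q, gauge q ->
    exists C : R, forall x : 'rV[K]_k.+1, q (h i k x) <= C) ->
  forall q, gauge q ->
    exists C : R, forall x, q (series_family k x) <= C.
Proof.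
move=> hb q gq; have [q' gq' qq'] := gauge_maxD gq.
have [N hN] := series_family_tail k gq' ltr01.
have [C hC] : exists C : R, forall x : 'rV[K]_k.+1,
    q' (\sum_(0 <= i < N) h i k x) <= C.
  elim: (N) q' gq' {qq' hN} => [|n ih] q' gq'.
    by exists 0 => x; rewrite big_geq// gauge0.
  have [q2 gq2 qq2] := gauge_maxD gq'; have [C hC] := ih _ gq2.
  have [C' hC'] := hb n _ gq2; exists (Num.max C C') => x.
  rewrite big_nat_recr//= (le_trans (qq2 _ _))// ge_max !le_max hC hC'.
  by rewrite orbT.
exists (Num.max C 1) => x.
rewrite -[series_family k x](subrK (\sum_(0 <= i < N) h i k x)) addrC.
by rewrite (le_trans (qq' _ _))// ge_max !le_max hC (ltW (hN _)) orbT.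
Qed.

End Series.

(** * Sums estimated by a calibration *)

Section Calibrations.
Context {R : realType} {K : valuedFieldType R} {E : valuedTvsType K}.
Variables (Q : nat -> E -> R).
Hypothesis calQ : calibration Q.

Lemma calibration_mono m n x : (m <= n)%N -> Q m x <= Q n x.
Proof.
have [gQ QD] := calQ => /subnK <-; elim: (n - m)%N => // d ih.
by rewrite (le_trans ih)// -{1}[x]addr0 (le_trans (QD _ _ _))// gauge0// addr0.
Qed.

(** Splitting off the first term repeatedly raises the index of the gauge by
    one each time, and the weights [2^-(i+1)] add up to [2^-m]. *)
Lemma calibration_geometric_sum (y : nat -> E) (e : R) m n : 0 <= e ->
  (forall i, (m <= i)%N -> 2 ^+ i.+1 * Q i.+1 (y i) <= e) ->
  2 ^+ m * Q m (\sum_(m <= i < n) y i) <= e.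
Proof.
have [gQ QD] := calQ; move=> e0.
have [nm _|/ltnW/subnK <-] := leqP n m.
  by rewrite big_geq// gauge0// mulr0.
move: (n - m)%N => d; elim: d m => [|d ih] m hy.
  by rewrite big_geq// gauge0// mulr0.
rewrite addSn big_ltn ?ltnS ?leq_addl// -addnS.
have := hy m (leqnn m).
have := ih m.+1 (fun i mi => hy i (ltnW mi)).
have := ler_wpM2l (exprn_ge0 m (ler0n R 2))
  (QD m (y m) (\sum_(m.+1 <= i < d + m.+1) y i)).
rewrite exprS mulrDr -!mulrA; move: (2 ^+ m * _) (2 ^+ m * _) (2 ^+ m * _).
by move=> a b c; lra.
Qed.

End Calibrations.

(** * The disjoint balls *)

Section Balls.
Context {R : realType} {K : valuedFieldType R}.
Variables (hK : ultrametric K) (rho : K).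
Hypotheses (rho0 : rho != 0) (rho1 : absv rho < 1).

Lemma scaled_ballP n t : scaled_ball rho n t <-> absv t <= absv rho ^+ n.
Proof.
have r0 : rho ^+ n != 0 by rewrite expf_neq0.
split=> [[u u1 <-]|tn].
  by rewrite absvM absvX ler_piMr ?exprn_ge0 ?absv_ge0.
exists ((rho ^+ n)^-1 * t); last by rewrite mulVKf.
rewrite /unit_ball /= absvM absvV absvX mulrC ler_pdivrMr ?mul1r//.
by rewrite exprn_gt0// absv_gt0.
Qed.

Lemma scaled_ball_sep n x y : scaled_ball rho n x -> ~ scaled_ball rho n y ->
  absv rho ^+ n <= absv (x - y).
Proof.
move=> /scaled_ballP xn yn; rewrite leNgt; apply/negP => xy.
apply: yn; apply/scaled_ballP.
rewrite -[y](subrK x) (le_trans (hK _ _))// ge_max xn andbT absvBC.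
exact: ltW.
Qed.

(** Adding an element of smaller absolute value does not change the absolute
    value of the centre. *)
Lemma absv_in_ball i t : scaled_ball rho i.+1 (t - rho ^+ i) ->
  absv t = absv rho ^+ i.
Proof.
move=> /scaled_ballP ti.
have lti : absv (t - rho ^+ i) < absv (rho ^+ i).
  rewrite (le_lt_trans ti)// absvX exprS gtr_pMl//.
  by rewrite exprn_gt0// absv_gt0.
apply/eqP; rewrite -absvX eq_le; apply/andP; split.
  by rewrite -[t](subrK (rho ^+ i)) (le_trans (hK _ _))// ge_max lexx (ltW lti).
have := hK t (rho ^+ i - t); rewrite [t + _]addrC subrK le_max => /orP[//|].
by rewrite absvBC leNgt lti.
Qed.

Lemma ball_index_inj i j t : scaled_ball rho i.+1 (t - rho ^+ i) ->
  scaled_ball rho j.+1 (t - rho ^+ j) -> i = j.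
Proof.
move=> /absv_in_ball ti /absv_in_ball; rewrite ti => /ieexprIn; apply.
  exact: absv_gt0.
by rewrite lt_eqF.
Qed.

Lemma near_notin_ball t :
  \forall i \near \oo, ~ scaled_ball rho i.+1 (t - rho ^+ i).
Proof.
have [[i ti]|nt] := pselect (exists i, scaled_ball rho i.+1 (t - rho ^+ i)).
  by exists i.+1 => // j /= ij /(ball_index_inj ti) ij'; rewrite ij' ltnn in ij.
by apply: nearW => i ti; apply: nt; exists i.
Qed.

End Balls.

(** * Decay of the extended maps *)

Section Estimates.
Context {R : realType} {K : valuedFieldType R} {E : valuedTvsType K}.
Variables (hK : ultrametric K) (rho : K).
Hypotheses (rho0 : rho != 0) (rho1 : absv rho < 1).
Variable gamma_ : nat -> K -> E.

Let B n : set K := scaled_ball rho n.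
Let G n k : 'rV[K]_k.+1 -> E := zero_ext (B n) (ddiff (B n) (gamma_ n)) k.

Lemma ddiff_norm_lim (q : nat -> E -> R) k (a : R) : 0 < a ->
  ((a ^+ n)%:E * ddiff_norm (q n) (B n) (gamma_ n) k)%E @[n --> \oo] --> 0%E ->
  forall e : R, 0 < e -> \forall n \near \oo, forall x, rpow (B n) k.+1 x ->
    a ^+ n * q n (ddiff (B n) (gamma_ n) k x) <= e.
Proof.
move=> a0 lim e e0.
have : \forall n \near \oo,
    ((a ^+ n)%:E * ddiff_norm (q n) (B n) (gamma_ n) k < e%:E)%E.
  apply: (lim [set y | (y < e%:E)%E]).
  change (\forall r \near (0 : R), (r%:E < e%:E)%E).
  by apply: filterS (lt_nbhsl e0) => r; rewrite lte_fin.
apply: filterS => n ne x Bx.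
rewrite -lee_fin EFinM (le_trans _ (ltW ne))// lee_wpmul2l ?lee_fin ?exprn_ge0//.
  exact: ltW.
by apply: ereal_sup_ubound; exists x.
Qed.

(** Induction on [k]. Passing from [k] to [k+1] divides by a number of absolute
    value at least [|rho|^n], which is absorbed by replacing [a] with
    [a / |rho|], and splits a sum, which is absorbed by replacing [m] with [m+1]. *)
Lemma zero_ext_small (Q : nat -> E -> R) : calibration Q ->
  (forall (a : R) (k m : nat), 0 < a ->
    ((a ^+ n)%:E * ddiff_norm (Q (n + m)%N) (B n) (gamma_ n) k)%E
      @[n --> \oo] --> 0%E) ->
  forall k m (a e : R), 0 < a -> 0 < e ->
    \forall n \near \oo, forall x : 'rV[K]_k.+1, a ^+ n * Q (n + m)%N (G n x) <= e.
Proof.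
move=> [gQ QD] lim; elim=> [|k ih] m a e a0 e0.
  have := ddiff_norm_lim a0 (lim a 0%N m a0) e0; apply: filterS => n hn x.
  have an0 : 0 < a ^+ n by rewrite exprn_gt0.
  rewrite mulrC -ler_pdivlMr//; apply: zero_ext_gauge_le0 => //.
    by rewrite ltW// divr_gt0.
  by move=> y By; rewrite ler_pdivlMr// mulrC hn.
have r0 := absv_gt0 rho0.
have := ih m.+1 (a / absv rho) (e / 2) (divr_gt0 a0 r0) (divr_gt0 e0 (ltr0n R 2)).
have := ddiff_norm_lim a0 (lim a k.+1 m a0) e0; apply: filterS2 => n hn ihn x.
have an0 : 0 < a ^+ n by rewrite exprn_gt0.
have rn0 : 0 < absv rho ^+ n by rewrite exprn_gt0.
rewrite mulrC -ler_pdivlMr//.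
(* the bound that the induction hypothesis must supply is
   [(e / 2) (|rho| / a)^n], as [|rho|^-n] times its double is [e / a^n] *)
have -> : e / a ^+ n = Num.max (e / a ^+ n) ((absv rho ^+ n)^-1 *
    (absv rho ^+ n / a ^+ n * (e / 2) + absv rho ^+ n / a ^+ n * (e / 2))).
  rewrite -mulrDr -splitr -[_ / a ^+ n * e]mulrA mulKf ?gt_eqF//.
  by rewrite [_^-1 * e]mulrC maxxx.
apply: (zero_ext_gauge_leS rn0 (@scaled_ball_sep _ _ hK _ rho0 n)
  (q' := Q (n + m).+1)) => //.
- by rewrite ltW// divr_gt0.
- by rewrite ltW// !(mulr_gt0, divr_gt0, invr_gt0).
- by move=> y By; rewrite ler_pdivlMr// mulrC hn.
move=> y; have := ihn y; rewrite addnS => {}ihn.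
rewrite mulrC -ler_pdivrMr ?divr_gt0// invf_div.
by rewrite mulrC -expr_div_n.
Qed.

(** Same induction as for the decay; for a single [n] the denominators are
    bounded away from zero. *)
Lemma zero_ext_bounded n : BCoo (B n) (gamma_ n) -> forall k q, gauge q ->
  exists C : R, forall x : 'rV[K]_k.+1, q (G n x) <= C.
Proof.
move=> [_ bn].
have hb k q : gauge q -> exists2 C : R, 0 <= C & forall x, rpow (B n) k.+1 x ->
    q (ddiff (B n) (gamma_ n) k x) <= C.
  move=> gq; have [C hC] := (tvs_boundedP _).1 (bn k) q gq.
  exists (Num.max C 0); first by rewrite le_max lexx orbT.
  by move=> x Bx; rewrite le_max hC//; exists x.
elim=> [|k ih] q gq.
  have [C C0 hC] := hb 0%N q gq; exists C => x; exact: zero_ext_gauge_le0.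
have [q' gq' qq'] := gauge_maxD gq; have [C' hC'] := ih q' gq'.
have [C C0 hC] := hb k.+1 q gq.
have rn0 : 0 < absv rho ^+ n by rewrite exprn_gt0// absv_gt0.
exists (Num.max C ((absv rho ^+ n)^-1 * (Num.max C' 0 + Num.max C' 0))) => x.
apply: (zero_ext_gauge_leS rn0 (@scaled_ball_sep _ _ hK _ rho0 n) (q' := q')) => //.
- have [q'0 _ _] := gq'.
  move=> u v; rewrite (le_trans (qq' u v))// ge_max lerDl lerDr.
  by rewrite !q'0.
- by rewrite le_max lexx orbT.
- by move=> y; rewrite le_max hC'.
Qed.

End Estimates.

Theorem theorem3p1 (R : realType) (K : valuedFieldType R)
    (hK : ultrametric K) (E : valuedTvsType K) (hE : hausdorff_space E)
    (rho : K) (hrho0 : rho != 0) (hrho1 : absv rho < 1)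
    (gamma_ : nat -> K -> E)
    (hBC : forall n, (0 < n)%N -> BCoo (scaled_ball rho n) (gamma_ n))
    (hsmall : forall q : E -> R, gauge q ->
      exists Q : nat -> E -> R,
        [/\ calibration Q, Q 0%N = q &
            forall (a : R) (k m : nat), 0 < a ->
              ((a ^+ n)%:E *
                 ddiff_norm (Q (n + m)%N) (scaled_ball rho n) (gamma_ n) k)%E
                @[n --> \oo] --> 0%E]) :
  exists gamma : K -> E,
    [/\ BCoo setT gamma,
        range gamma `<=`
          [set 0] `|`
          \bigcup_(n in [set n | (0 < n)%N]) (gamma_ n @` scaled_ball rho n) &
        forall n t, (0 < n)%N -> scaled_ball rho n t ->
          gamma (rho ^+ n.-1 + t) = gamma_ n t].
Proof.
pose B n : set K := scaled_ball rho n.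
pose G n k : 'rV[K]_k.+1 -> E := zero_ext (B n) (ddiff (B n) (gamma_ n)) k.
(* the index [i] stands for [n - 1], so that the centres are [rho ^+ i] *)
pose f i (t : K) := patch (fun=> 0) (B i.+1) (gamma_ i.+1) (t - rho ^+ i).
pose h i k (x : 'rV[K]_k.+1) := G i.+1 k (x - const_mx (rho ^+ i)).
have fh i : dquot_family setT (f i) (h i).
  have ri0 : 0 < absv rho ^+ i.+1 by rewrite exprn_gt0// absv_gt0.
  have sep := scaled_ball_sep hK hrho0 (n := i.+1).
  apply: (dquot_family_translate (h := G i.+1)).
  apply: (zero_ext_dquot_family ri0) => //.
  by apply: smooth_dquot_family; have [] := hBC i.+1 isT.
have h_fin k (x : 'rV[K]_k.+1) : exists N, forall i, (N <= i)%N -> h i k x = 0.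
  have : \forall i \near \oo, forall j, ~ B i.+1 (x 0 j - rho ^+ i).
    by apply: filter_forall => j; exact: near_notin_ball.
  move=> [N _ hN]; exists N => i Ni; apply: zero_ext_out => j.
  by rewrite !mxE; exact: hN.
have h_tail k q : gauge q -> forall e : R, 0 < e ->
  exists N, forall M (x : 'rV[K]_k.+1), q (\sum_(N <= i < M) h i k x) < e.
  move=> gq e e0; have [Q [calQ <- lim]] := hsmall q gq.
  have [N _ hN] := zero_ext_small hK hrho0 calQ lim k 0 (ltr0n R 2)
     (divr_gt0 e0 (ltr0n R 2)).
  exists N => M x.
  have := @calibration_geometric_sum _ _ _ Q calQ (fun i => h i k x) (e / 2) N M.
  rewrite ltW ?divr_gt0// => /(_ isT) H.
  rewrite (le_lt_trans (calibration_mono calQ _ (leq0n N)))//.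
  apply: le_lt_trans (_ : e / 2 < e); last first.
    by rewrite ltr_pdivrMr// ltr_pMr// ltr1n.
  apply: le_trans (H _).
    rewrite ler_peMl//; first by have [+ _] := calQ => /(_ N)[].
    by rewrite exprn_ege1// ler1n.
  move=> i Ni; rewrite /h -[X in Q X]addn0; apply: (hN i.+1); exact: leqW.
pose H := series_family h_fin.
pose gamma t := H 0%N (const_mx t).
have gammaH : dquot_family setT gamma H by exact: series_dquot_family.
have gammaE n t : (0 < n)%N -> scaled_ball rho n t ->
    gamma (rho ^+ n.-1 + t) = gamma_ n t.
  case: n => // n _ tn /=.
  have tn' : B n.+1 (rho ^+ n + t - rho ^+ n) by rewrite addrC addKr.
  pose x : 'rV[K]_1 := const_mx (rho ^+ n + t).
  have [N hN] := series_family_eventually h_fin x.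
  have nM : (n < maxn N n.+1)%N by rewrite leq_maxr.
  rewrite /gamma /H (hN (maxn N n.+1)) ?leq_maxl// big_mkord.
  rewrite (bigD1 (Ordinal nM))//= big1 => [|i ni].
    rewrite addr0 /h /G zero_ext_in/=; last by move=> j; rewrite !mxE.
    by rewrite !mxE addrC addKr.
  apply: zero_ext_out => j; rewrite !mxE => ti; move: ni; apply/negP/negPn/eqP.
  apply: val_inj => /=; exact: ball_index_inj ti tn'.
exists gamma; split => //.
- split; first exact: dquot_family_smooth gammaH.
  move=> k; rewrite (ddiff_eq hE gammaH); apply/tvs_boundedP => q gq.
  have [i r gr|C hC] := series_family_bounded h_fin h_tail (k := k) _ gq.
    have [C hC] := zero_ext_bounded hK hrho0 (hBC i.+1 isT) k gr.
    by exists C => x; exact: hC.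
  by exists C => _ [x _ <-]; exact: hC.
- move=> _ [t _ <-].
  have [[i ti]|nt] := pselect (exists i, scaled_ball rho i.+1 (t - rho ^+ i)).
    right; exists i.+1 => //; exists (t - rho ^+ i) => //.
    by rewrite -gammaE// addrC subrK.
  left; rewrite /= /gamma /H /series_family big1// => i _.
  apply: zero_ext_out => j; rewrite !mxE => tj; apply: nt; by exists i.
Qed.
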